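(* Let $0<q<1$. For any $\rho\in\mathbb{R}$ and $\tau>0$, and for any polynomial $f(z)=\sum_{n=0}^\infty f_n z^n$ (with complex coefficients $f_n$, only finitely many of which are non-zero), we have $$(1-q^{\tau})\int_{-\pi}^{\pi}\left|(1-q^{\tau/2}e^{i\theta})^{-1}f(q^{\rho/2}e^{i\theta})\right|^2\frac{d\theta}{2\pi}=\sum_{n,m=0}^\infty [A(\tau,\rho)]_{n,m}\,f_n\overline{f_m}.$$
   Context: For $0<q<1$ and real $\tau,\rho$, $A(\tau,\rho)$ is the semi-infinite matrix indexed by $n,m\in\{0,1,2,\dots\}$ with entries $$[A(\tau,\rho)]_{n,m}=\frac{q^{\tau(n\vee m)}}{q^{\tau(n+m)/2}}\,q^{\rho(n+m)/2},$$ where $n\vee m=\max\{n,m\}$. *)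

(* Defs.v *)
From HB Require Import structures.
From mathcomp Require Import all_boot all_order all_algebra.
From mathcomp Require Import all_classical all_reals all_analysis.
From mathcomp Require Import complex.

Set Implicit Arguments.
Unset Strict Implicit.
Unset Printing Implicit Defensive.

Import Order.TTheory GRing.Theory Num.Theory.
Local Open Scope ring_scope.
Local Open Scope complex_scope.

(* A semi-infinite matrix, indexed by nat * nat and depending on the base q;
   q `^ x is the power with real exponent x. *)
Definition Amx (R : realType) (q tau rho : R) (n m : nat) : R :=
  q `^ (tau * (maxn n m)%:R) / q `^ (tau * (n + m)%:R / 2)
    * q `^ (rho * (n + m)%:R / 2).

(* e^{i theta}; the complex exponential is not in the libraries used. *)
Definition expi (R : realType) (theta : R) : R[i] := cos theta +i* sin theta.

(* Main.v *)
Require Import Defs.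
From HB Require Import structures.
From mathcomp Require Import all_boot all_order all_algebra.
From mathcomp Require Import all_classical all_reals all_analysis.
From mathcomp Require Import complex ring lra.
Set Implicit Arguments.
Unset Strict Implicit.
Unset Printing Implicit Defensive.

Import Order.TTheory GRing.Theory Num.Theory.
Import numFieldNormedType.Exports.
Local Open Scope classical_set_scope.
Local Open Scope complex_scope.
Local Open Scope ring_scope.

(** Put t = q^(tau/2), r = q^(rho/2) and E = e^(i theta), so that 0 < t < 1. The
    factor (1 - t^2) / |1 - t E|^2 is the Poisson kernel of the unit disc,
    [poisson t theta], and its Fourier coefficients are t^|k|. Expanding
    |f (r E)|^2 as the double sum of r^(n+m) f_n conj(f_m) E^n conj(E)^m
    ([horner_sqr_norm]) and integrating term by term therefore produces
    t^|n-m| r^(n+m), which is the entry A(tau, rho)_(n,m) because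
    2 max(n, m) - (n + m) = |n - m| ([Amx_geometric]).

    The Fourier coefficients are computed without expanding the kernel in a
    series. Multiplying the kernel by its denominator
    1 + t^2 - t (E + conj E) gives the constant 1 - t^2 ([poissonE]); integrated
    against E^(k+1), whose own integral is 0, this says that the moments u_k of
    the kernel satisfy (1 + t^2) u_(k+1) = t (u_(k+2) + u_k). The solutions of
    this recurrence are spanned by t^k and t^(-k), and the moments are bounded
    because the kernel is positive, so u_k = t^k u_0
    ([bounded_recurrence_geometric]). The same identity integrated against 1
    then determines u_0 = 2 pi. *)

(** * Bounded solutions of a second-order recurrence *)

(** The operator factors: d_k = u_(k+1) - t u_k satisfies d_k = t d_(k+1). Hence
    d_0 = t^j d_j for all j, and this tends to 0 when u is bounded. *)
Lemma bounded_recurrence_geometric (R : realType) (t M : R) (u : nat -> R) :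
    0 < t -> t < 1 ->
    (forall k, (1 + t ^+ 2) * u k.+1 = t * (u k.+2 + u k)) ->
    (forall k, `|u k| <= M) ->
  forall k, u k = t ^+ k * u 0%N.
Proof.
move=> t0 t1 urec ubd.
suff ustep k : u k.+1 = t * u k.
  by elim=> [|k IHk]; rewrite ?expr0 ?mul1r // ustep IHk exprS mulrA.
pose d j := u (k + j).+1 - t * u (k + j)%N.
have d0E j : d 0%N = t ^+ j * d j.
  elim: j => [|j ->]; first by rewrite expr0 mul1r.
  rewrite exprSr -mulrA; congr (_ * _); rewrite /d addnS.
  rewrite mulrBr -[t * u (k + j).+2](addrK (t * u (k + j)%N)) -mulrDr -urec.
  by ring.
have d0le j : `|d 0%N| <= 2 * M * t ^+ j.
  rewrite (d0E j) normrM (ger0_norm (exprn_ge0 _ (ltW t0))) mulrC.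
  rewrite ler_wpM2r ?exprn_ge0 ?(ltW t0) //.
  rewrite /d (le_trans (ler_normB _ _)) // normrM (gtr0_norm t0).
  have := ubd (k + j).+1; have := ubd (k + j).
  have := normr_ge0 (u (k + j)%N).
  nra.
suff d00 : d 0%N = 0 by apply/eqP; rewrite -subr_eq0 -d00 /d addn0.
apply/eqP; rewrite -normr_le0; apply/ler_addgt0Pr => e e0; rewrite add0r.
have : (geometric (2 * M) t : R ^nat) x @[x --> \oo] --> 0.
  by apply: cvg_geometric; rewrite gtr0_norm.
move=> /cvgrPdist_lt /(_ _ e0)[N _ /(_ N (leqnn N))] /=.
rewrite sub0r normrN => /ltW; apply: le_trans.
exact: le_trans (d0le N) (ler_norm _).
Qed.

(** * Integrating complex-valued functions over a period *)

(** Continuity is read on the real and imaginary parts, because it serves to make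
    the two real integrals that form [cint] converge. *)
Definition ccontinuous (R : realType) (g : R -> R[i]) :=
  continuous (fun x => complex.Re (g x)) /\
  continuous (fun x => complex.Im (g x)).

Definition cint (R : realType) (g : R -> R[i]) : R[i] :=
  (\int[lebesgue_measure]_(x in `[- pi, pi]) complex.Re (g x)) +i*
  (\int[lebesgue_measure]_(x in `[- pi, pi]) complex.Im (g x)).

Section Integral.
Variable R : realType.
Implicit Types (g h : R -> R[i]) (u v : R -> R) (c : R[i]) (t x : R).

Lemma continuous_integrable_pi u :
  continuous u ->
  (@lebesgue_measure R).-integrable `[- pi, pi] (EFin \o u).
Proof.
move=> uc; apply: continuous_compact_integrable; first exact: segment_compact.
exact: continuous_subspaceT.
Qed.

Lemma ReM c c' : complex.Re (c * c') =
  complex.Re c * complex.Re c' - complex.Im c * complex.Im c'.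
Proof. by case: c c' => [a b] [a' b']. Qed.

Lemma ImM c c' : complex.Im (c * c') =
  complex.Re c * complex.Im c' + complex.Im c * complex.Re c'.
Proof. by case: c c' => [a b] [a' b']. Qed.

Lemma conjM c c' : (c * c')^* = c^* * c'^*.
Proof. exact: rmorphM. Qed.

Lemma conjX c n : (c ^+ n)^* = c^* ^+ n.
Proof. exact: rmorphXn. Qed.

Lemma conj_real a : (a%:C)^* = a%:C :> R[i].
Proof. exact: conjc_real. Qed.

Lemma ccontinuous_cst c : ccontinuous (fun _ : R => c).
Proof. by split => x; exact: cvg_cst. Qed.

Lemma ccontinuous_real u : continuous u -> ccontinuous (fun x => (u x)%:C).
Proof. by move=> uc; split => // x; exact: cvg_cst. Qed.

Lemma ccontinuous_conj g :
  ccontinuous g -> ccontinuous (fun x => (g x)^*).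
Proof.
move=> [gr gi]; split=> x /=.
- rewrite (_ : (fun _ => _) = fun x => complex.Re (g x)); first exact: gr.
  by apply: funext => y; case: (g y).
- rewrite (_ : (fun _ => _) = fun x => - complex.Im (g x)).
    by apply: cvgN; exact: gi.
  by apply: funext => y; case: (g y).
Qed.

Lemma ccontinuousD g h :
  ccontinuous g -> ccontinuous h -> ccontinuous (fun x => g x + h x).
Proof.
move=> [gr gi] [hr hi]; split=> x.
- rewrite (_ : (fun _ => _) = fun x => complex.Re (g x) + complex.Re (h x)).
    by apply: cvgD; [exact: gr | exact: hr].
  by apply: funext => y; case: (g y); case: (h y).
- rewrite (_ : (fun _ => _) = fun x => complex.Im (g x) + complex.Im (h x)).
    by apply: cvgD; [exact: gi | exact: hi].
  by apply: funext => y; case: (g y); case: (h y).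
Qed.

Lemma ccontinuousM g h :
  ccontinuous g -> ccontinuous h -> ccontinuous (fun x => g x * h x).
Proof.
move=> [gr gi] [hr hi]; split=> x.
- under eq_fun do rewrite ReM.
  by apply: cvgB; apply: cvgM; [exact: gr|exact: hr|exact: gi|exact: hi].
- under eq_fun do rewrite ImM.
  by apply: cvgD; apply: cvgM; [exact: gr|exact: hi|exact: gi|exact: hr].
Qed.

Lemma ccontinuousX g n : ccontinuous g -> ccontinuous (fun x => g x ^+ n).
Proof.
move=> gc; elim: n => [|n IHn]; first exact: ccontinuous_cst.
by under eq_fun do rewrite exprS; exact: ccontinuousM.
Qed.

Lemma ccontinuous_sum n (G : 'I_n -> R -> R[i]) :
  (forall i, ccontinuous (G i)) -> ccontinuous (fun x => \sum_(i < n) G i x).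
Proof.
move=> Gc; elim: n G Gc => [|n IHn] G Gc.
  by under eq_fun do rewrite big_ord0; exact: ccontinuous_cst.
under eq_fun do rewrite big_ord_recl.
by apply: ccontinuousD; [exact: Gc | exact: (IHn (fun i => G (lift ord0 i)))].
Qed.

Lemma eq_cint g h : g =1 h -> cint g = cint h.
Proof. by move=> /funext ->. Qed.

Lemma cint_real u : cint (fun x => (u x)%:C) =
  (\int[lebesgue_measure]_(x in `[- pi, pi]) u x)%:C.
Proof. by rewrite /cint /= Rintegral_cst // mul0r. Qed.

Lemma cint_conj g : ccontinuous g -> cint (fun x => (g x)^*) = (cint g)^*.
Proof.
move=> [_ gi]; rewrite /cint /=; congr (_ +i* _).
- by apply: eq_Rintegral => x _; case: (g x).
- rewrite -[RHS]mulN1r -RintegralZl //; last exact: continuous_integrable_pi.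
  by apply: eq_Rintegral => x _; rewrite mulN1r; case: (g x).
Qed.

Lemma cintD g h : ccontinuous g -> ccontinuous h ->
  cint (fun x => g x + h x) = cint g + cint h.
Proof.
move=> [gr gi] [hr hi]; rewrite /cint.
under eq_Rintegral => x _ do rewrite raddfD /=.
rewrite RintegralD //; try exact: continuous_integrable_pi.
under [X in _ +i* X]eq_Rintegral => x _ do rewrite raddfD /=.
by rewrite RintegralD //; exact: continuous_integrable_pi.
Qed.

Lemma cintZ c g : ccontinuous g -> cint (fun x => c * g x) = c * cint g.
Proof.
move=> [gr gi]; rewrite /cint; case: c => a b.
have crint e u : continuous u ->
    lebesgue_measure.-integrable `[- pi, pi] (EFin \o (fun x => e * u x)).
  move=> uc; apply: continuous_integrable_pi => x.
  by apply: cvgM; [exact: cvg_cst | exact: uc].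
under eq_Rintegral => x _ do rewrite ReM /=.
rewrite RintegralB //; try exact: crint.
under [X in _ +i* X]eq_Rintegral => x _ do rewrite ImM /=.
rewrite RintegralD //; try exact: crint.
by rewrite !RintegralZl //; exact: continuous_integrable_pi.
Qed.

Lemma cint_sum n (G : 'I_n -> R -> R[i]) :
  (forall i, ccontinuous (G i)) ->
  cint (fun x => \sum_(i < n) G i x) = \sum_(i < n) cint (G i).
Proof.
move=> Gc; elim: n G Gc => [|n IHn] G Gc.
  rewrite big_ord0 -[RHS](mul0r (cint (fun=> 0))) -cintZ;
    last exact: ccontinuous_cst.
  by apply: eq_cint => x; rewrite big_ord0 mul0r.
rewrite big_ord_recl -IHn; last by move=> i; exact: Gc.
rewrite -cintD //; last by apply: ccontinuous_sum => i; exact: Gc.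
by apply: eq_cint => x; rewrite big_ord_recl.
Qed.

(** * Integrals of powers of the exponential *)

Lemma expi_conjM x : expi x * (expi x)^* = 1.
Proof.
rewrite -[_^*]/(conjc _) /expi; simpc.
by rewrite -!expr2 (cos2Dsin2 x) (mulrC (sin x)) addNr.
Qed.

Lemma expi_exp x n : expi x ^+ n = expi (x *+ n).
Proof.
elim: n => [|n IHn]; first by rewrite expr0 mulr0n /expi cos0 sin0.
by rewrite exprS IHn mulrS /expi cosD sinD; simpc; rewrite [cos x * sin _ + _]addrC.
Qed.

Lemma expi_period : expi (- pi) = expi pi :> R[i].
Proof. by rewrite /expi cosN sinN sinpi oppr0. Qed.

Lemma ccontinuous_expi : ccontinuous (@expi R).
Proof. by split => x; [exact: continuous_cos | exact: continuous_sin]. Qed.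

Lemma Rintegral_derive_pi (F u : R -> R) :
  (forall x, is_derive x 1 F (u x)) -> continuous u -> F (- pi) = F pi ->
  \int[lebesgue_measure]_(x in `[- pi, pi]) u x = 0.
Proof.
move=> Fu uc Fpi; rewrite /Rintegral (@continuous_FTC2 _ u F).
- by rewrite Fpi subee.
- by have := pi_gt0 R; lra.
- exact: continuous_subspaceT.
- have Fc : continuous F.
    by move=> x; apply/differentiable_continuous/derivable1_diffP.
  split; first by move=> x _; exact: ex_derive.
  + by apply: cvg_at_right_filter; exact: Fc.
  + by apply: cvg_at_left_filter; exact: Fc.
- by move=> x _; rewrite derive1E derive_val.
Qed.

Lemma cint_expi n : cint (fun x => expi x ^+ n) = ((2 * pi) *+ (n == 0%N))%:C.
Proof.
case: n => [|n].
  rewrite (eq_cint (h := fun=> 1%:C)) // cint_real.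
  have pi0 := pi_gt0 R; congr (_%:C).
  transitivity (1 * fine (lebesgue_measure (`[- pi, pi]%classic : set R))).
    exact: Rintegral_cst.
  by rewrite lebesgue_measure_itv /= lte_fin ifT /=; lra.
have n0 : n.+1%:R != 0 :> R by rewrite pnatr_eq0.
(* The antiderivatives take equal values at both ends: e^(i x) does. *)
have [Ecos Esin] : cos (- pi * n.+1%:R) = cos (pi * n.+1%:R) :> R /\
    sin (- pi * n.+1%:R) = sin (pi * n.+1%:R) :> R.
  have : expi (- pi * n.+1%:R) = expi (pi * n.+1%:R) :> R[i].
    by rewrite !mulr_natr -(expi_exp pi) -(expi_exp (- pi)) expi_period.
  by case.
rewrite (eq_cint (h := fun x => expi (x * n.+1%:R))); last first.
  by move=> x; rewrite expi_exp mulr_natr.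
rewrite mulr0n /cint /=; congr (_ +i* _).
- apply: (@Rintegral_derive_pi (fun x => n.+1%:R^-1 * sin (x * n.+1%:R))).
  + move=> x; apply: is_derive_eq; rewrite /GRing.scale /=.
    by field.
  + move=> x; apply: continuous_comp; last exact: continuous_cos.
    by apply: cvgM; [exact: cvg_id | exact: cvg_cst].
  + by rewrite Esin.
- apply: (@Rintegral_derive_pi (fun x => - n.+1%:R^-1 * cos (x * n.+1%:R))).
  + move=> x; apply: is_derive_eq; rewrite /GRing.scale /=.
    by field.
  + move=> x; apply: continuous_comp; last exact: continuous_sin.
    by apply: cvgM; [exact: cvg_id | exact: cvg_cst].
  + by rewrite Ecos.
Qed.

(** * The Poisson kernel and its moments *)

(** The denominator is |1 - t e^(i x)|^2, see [normC_one_sub_expi]. *)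
Definition poisson t x := (1 - t ^+ 2) / (1 + t ^+ 2 - 2 * t * cos x).

(** The denominator is at least (1 - t)^2, its value at x = 0. *)
Lemma poisson_den_gt0 t x : 0 < t -> t < 1 -> 0 < 1 + t ^+ 2 - 2 * t * cos x.
Proof.
move=> t0 t1; have := cos_le1 x => ?.
apply: (@lt_le_trans _ _ ((1 - t) ^+ 2)).
  by rewrite exprn_gt0 // subr_gt0.
by nra.
Qed.

Lemma poisson_ge0 t x : 0 < t -> t < 1 -> 0 <= poisson t x.
Proof.
move=> t0 t1; rewrite divr_ge0 ?(ltW (poisson_den_gt0 _ _ _)) //.
by rewrite subr_ge0 expr_le1 ?ltW.
Qed.

Lemma continuous_poisson t : 0 < t -> t < 1 -> continuous (poisson t).
Proof.
move=> t0 t1 x; apply: cvgM; first exact: cvg_cst.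
apply: cvgV; first by rewrite gt_eqF // poisson_den_gt0.
apply: cvgB; first exact: cvg_cst.
by apply: cvgM; [exact: cvg_cst | exact: continuous_cos].
Qed.

Lemma normC_one_sub_expi t x :
  `|1 - t%:C * expi x| ^+ 2 = (1 + t ^+ 2 - 2 * t * cos x)%:C.
Proof.
rewrite -add_Re2_Im2 /expi; congr (_%:C); simpc => /=.
have := cos2Dsin2 x; move: (cos x) (sin x) => c s /(canRL (addKr _)) cs.
by rewrite sqrrN exprMn cs; ring.
Qed.

Section Moments.
Variable t : R.
Hypotheses (t0 : 0 < t) (t1 : t < 1).

(* [pint n] is the n-th moment of the kernel, denoted u_n above. *)
Let pint n := cint (fun x => (poisson t x)%:C * expi x ^+ n).

Let ccontinuous_pexpi n : ccontinuous (fun x => (poisson t x)%:C * expi x ^+ n).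
Proof.
apply: ccontinuousM; first exact/ccontinuous_real/continuous_poisson.
exact/ccontinuousX/ccontinuous_expi.
Qed.

Lemma poissonE x : (poisson t x)%:C *
  ((1 + t ^+ 2)%:C - t%:C * (expi x + (expi x)^*)) = (1 - t ^+ 2)%:C.
Proof.
have -> : expi x + (expi x)^* = (2 * cos x)%:C.
  rewrite -[_^*]/(conjc _) /expi; apply/eqP; rewrite eq_complex /=.
  by apply/andP; split; apply/eqP; ring.
rewrite -rmorphM -rmorphB -rmorphM; congr (_%:C); rewrite /poisson.
have := poisson_den_gt0 x t0 t1 => d0.
by field; rewrite lt0r_neq0.
Qed.

(* The identity [poissonE] times E^(n+1), with E conj(E) = 1 lowering the power
   in the conjugate term. *)
Let poisson_exp_rec x n :
  (1 + t ^+ 2)%:C * ((poisson t x)%:C * expi x ^+ n.+1) =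
  t%:C * ((poisson t x)%:C * expi x ^+ n.+2 + (poisson t x)%:C * expi x ^+ n) +
  (1 - t ^+ 2)%:C * expi x ^+ n.+1.
Proof.
rewrite -(poissonE x).
have En : expi x ^+ n = (expi x)^* * expi x ^+ n.+1.
  by rewrite exprS mulrA [_^* * _]mulrC expi_conjM mul1r.
rewrite (exprS _ n.+1) En; move: (expi x ^+ n.+1) (expi x)^* => e1 e'.
ring.
Qed.

Let pint_rec n : (1 + t ^+ 2)%:C * pint n.+1 = t%:C * (pint n.+2 + pint n).
Proof.
rewrite /pint -cintZ // (eq_cint (fun x => poisson_exp_rec x n)).
have Ec := ccontinuousX n.+1 ccontinuous_expi.
have tc := ccontinuous_cst t%:C; have tc' := ccontinuous_cst (1 - t ^+ 2)%:C.
rewrite cintD; last 2 first.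
- by apply: ccontinuousM => //; exact: ccontinuousD.
- exact: ccontinuousM.
rewrite !cintZ //; last exact: ccontinuousD.
by rewrite cintD // cint_expi mulr0n mulr0 addr0.
Qed.

(* This is the bound on the moments: the kernel is nonnegative, so it may be
   taken out of the absolute value. *)
Let poisson_integral_le u : continuous u -> (forall x, `|u x| <= 1) ->
  `|\int[lebesgue_measure]_(x in `[- pi, pi]) (poisson t x * u x)| <=
  \int[lebesgue_measure]_(x in `[- pi, pi]) poisson t x.
Proof.
move=> uc u1; have pc := continuous_poisson t0 t1.
have puc : continuous (fun x => poisson t x * u x).
  by move=> x; apply: cvgM; [exact: pc | exact: uc].
apply: le_trans (le_normr_Rintegral _ (continuous_integrable_pi puc)) _ => //.
apply: le_Rintegral => //; try apply: continuous_integrable_pi => //.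
- by move=> x; apply: cvg_norm; exact: puc.
- move=> x _; rewrite normrM ger0_norm ?poisson_ge0 //.
  by rewrite ler_piMr ?poisson_ge0.
Qed.

Let pint_geometric n : pint n = (t ^+ n)%:C * pint 0%N.
Proof.
pose M := \int[lebesgue_measure]_(x in `[- pi, pi]) poisson t x.
have Re_real a z : complex.Re (a%:C * z) = a * complex.Re z :> R.
  by rewrite ReM /= mul0r subr0.
have Im_real a z : complex.Im (a%:C * z) = a * complex.Im z :> R.
  by rewrite ImM /= mul0r addr0.
apply/eqP; rewrite eq_complex Re_real Im_real; apply/andP; split; apply/eqP.
- pose v k := complex.Re (pint k).
  apply: (@bounded_recurrence_geometric _ t M v) => // k; rewrite /v.
    by have := congr1 (@complex.Re R) (pint_rec k); rewrite !Re_real raddfD.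
  rewrite [complex.Re _]/=; under eq_Rintegral => x _ do rewrite Re_real.
  apply: poisson_integral_le; first exact: (ccontinuousX k ccontinuous_expi).1.
  by move=> x; rewrite expi_exp ler_norml cos_geN1 cos_le1.
- pose v k := complex.Im (pint k).
  apply: (@bounded_recurrence_geometric _ t M v) => // k; rewrite /v.
    by have := congr1 (@complex.Im R) (pint_rec k); rewrite !Im_real raddfD.
  rewrite [complex.Im _]/=; under eq_Rintegral => x _ do rewrite Im_real.
  apply: poisson_integral_le; first exact: (ccontinuousX k ccontinuous_expi).2.
  by move=> x; rewrite expi_exp ler_norml sin_geN1 sin_le1.
Qed.

(** Geometric decay reduces this to the moment of order 0. There the recurrence
    involves the moment of order -1, the conjugate of the moment of order 1, and
    reads (1 + t^2) u_0 = 2 t^2 u_0 + (1 - t^2) 2 pi. *)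
Lemma cint_poisson_expi n : pint n = (2 * pi * t ^+ n)%:C.
Proof.
suff p0 : pint 0%N = (2 * pi)%:C by rewrite pint_geometric p0 -rmorphM mulrC.
have E0 : (1 + t ^+ 2)%:C * pint 0%N =
    t%:C * (pint 1%N + (pint 1%N)^*) + (1 - t ^+ 2)%:C * (2 * pi)%:C.
  (* [poissonE] itself, with the conjugate of the kernel times E in place of
     a power of order -1. *)
  have tE x : (1 + t ^+ 2)%:C * ((poisson t x)%:C * expi x ^+ 0) =
      t%:C * ((poisson t x)%:C * expi x ^+ 1 +
              ((poisson t x)%:C * expi x ^+ 1)^*) +
      (1 - t ^+ 2)%:C * expi x ^+ 0.
    rewrite -(poissonE x) expr0 expr1 mulr1 conjM conj_real; ring.
  have cst z := ccontinuous_cst z; have Ec := ccontinuousX 0 ccontinuous_expi.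
  have pc := ccontinuous_conj (ccontinuous_pexpi 1).
  rewrite /pint -cintZ // (eq_cint tE) cintD; last 2 first.
  - by apply: ccontinuousM => //; exact: ccontinuousD.
  - exact: ccontinuousM.
  rewrite !cintZ //; last exact: ccontinuousD.
  by rewrite cintD // cint_conj // cint_expi mulr1n.
(* The moment of order 0 is the integral of a real function. *)
have p0r : (pint 0%N)^* = pint 0%N.
  rewrite /pint (eq_cint (h := fun x => (poisson t x)%:C)).
    by rewrite cint_real conj_real.
  by move=> x; rewrite expr0 mulr1.
have t2 : (1 - t ^+ 2)%:C != 0.
  by rewrite -[0]/(0%:C) (inj_eq (@complexI R)) gt_eqF // subr_gt0 expr_lt1 ?ltW.
apply: (mulfI t2); move: E0.
rewrite (pint_geometric 1) expr1 conjM p0r conj_real => E0.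
apply: (addrI (t%:C * (t%:C * pint 0%N + t%:C * pint 0%N))).
rewrite -E0 !(rmorphB, rmorphD, rmorphXn, rmorph1) /=; ring.
Qed.

(** Since E conj(E) = 1, this is a moment of order n - m; as the kernel is real,
    moments of negative order are conjugates of those of positive order. The
    truncated difference of max and min is |n - m|. *)
Lemma cint_poisson_expi_conj n m :
  cint (fun x => (poisson t x)%:C * (expi x ^+ n * (expi x)^* ^+ m)) =
  (2 * pi * t ^+ (maxn n m - minn n m))%:C.
Proof.
have EE x k : expi x ^+ k * (expi x)^* ^+ k = 1.
  by rewrite -exprMn expi_conjM expr1n.
case: (leqP m n) => [/subnK <-|/ltnW /subnK <-].
- rewrite addnK -cint_poisson_expi; apply: eq_cint => x.
  by rewrite exprD -mulrA EE mulr1.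
- rewrite addnK -conj_real -cint_poisson_expi -cint_conj //.
  apply: eq_cint => x.
  rewrite conjM conj_real conjX [(_ - _ + n)%N]addnC exprD.
  by rewrite [expi x ^+ n * _]mulrA EE mul1r.
Qed.

End Moments.

End Integral.

(** * The matrix entries and the quadratic form *)

(** The exponent of q^(tau/2) is 2 max(n, m) - (n + m) = max(n, m) - min(n, m). *)
Lemma Amx_geometric (R : realType) (q tau rho : R) (n m : nat) : 0 < q ->
  Amx q tau rho n m = (q `^ (tau / 2)) ^+ (maxn n m - minn n m) *
                      ((q `^ (rho / 2)) ^+ n * (q `^ (rho / 2)) ^+ m).
Proof.
move=> q0; rewrite /Amx -exprD.
have pow s k : q `^ (s * k%:R / 2) = (q `^ (s / 2)) ^+ k.
  by rewrite mulrAC powRrM powR_mulrn // powR_ge0.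
have dbl : q `^ (tau * (maxn n m)%:R) = (q `^ (tau / 2)) ^+ (maxn n m + maxn n m).
  by rewrite -pow; congr (_ `^ _); rewrite natrD; field.
rewrite dbl !pow; congr (_ * _).
have tn0 : q `^ (tau / 2) != 0 by rewrite gt_eqF // powR_gt0.
have le : (minn n m <= maxn n m)%N by rewrite geq_min leq_maxl.
rewrite -(addn_min_max n m); apply: (canLR (mulfK _)); first exact: expf_neq0.
by rewrite -exprD addnA subnK.
Qed.

Lemma horner_sqr_norm (R : realType) (f : {poly R[i]}) (c E : R[i]) :
  `|f.[c * E]| ^+ 2 = \sum_(n < size f) \sum_(m < size f)
    c ^+ n * c^* ^+ m * f`_n * (f`_m)^* * (E ^+ n * E^* ^+ m).
Proof.
rewrite normCK horner_coef rmorph_sum /= mulr_suml.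
apply: eq_bigr => n _; rewrite mulr_sumr; apply: eq_bigr => m _.
rewrite conjM conjX conjM !exprMn; ring.
Qed.

Local Open Scope complex_scope.

Theorem proposition2p1 (R : realType) (q : R) (hq0 : 0 < q) (hq1 : q < 1)
    (rho tau : R) (htau : 0 < tau) (f : {poly R[i]}) :
  ((1 - q `^ tau) *
     (\int[lebesgue_measure]_(theta in `[- pi, pi])
        (complex.Re `| (1 - (q `^ (tau / 2))%:C * expi theta)^-1
                       * f.[(q `^ (rho / 2))%:C * expi theta] | ^+ 2
         / (2 * pi))))%:C
  = \sum_(n < size f) \sum_(m < size f)
      (Amx q tau rho n m)%:C * f`_n * (f`_m)^*.
Proof.
pose t := q `^ (tau / 2); pose r := q `^ (rho / 2).
have t0 : 0 < t by exact: powR_gt0.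
have t1 : t < 1.
  have := gt0_ltr_powR (divr_gt0 htau (ltr0Sn R 1)).
  move=> /(_ q 1); rewrite !nnegrE (ltW hq0) ler01 powR1.
  by apply.
have t2 : q `^ tau = t ^+ 2.
  by rewrite -powR_mulrn ?powR_ge0 // -powRrM; congr (_ `^ _); field.
have pin0 : pi != 0 :> R by rewrite lt0r_neq0 // pi_gt0.
(* [w n m] absorbs the constant that turns |1 - t E|^(-2) / (2 pi) into the
   Poisson kernel. *)
pose w n m : R[i] := ((2 * pi)^-1 / (1 - t ^+ 2))%:C *
  (r%:C ^+ n * (r%:C)^* ^+ m * f`_n * (f`_m)^*).
have t2n0 : 1 - t ^+ 2 != 0.
  by rewrite gt_eqF // subr_gt0 expr_lt1 ?ltW.
have integrand x :
    (complex.Re `| (1 - t%:C * expi x)^-1 * f.[r%:C * expi x] | ^+ 2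
      / (2 * pi))%:C =
    \sum_(n < size f) \sum_(m < size f)
      w n m * ((poisson t x)%:C * (expi x ^+ n * (expi x)^* ^+ m)).
  have ReK (z : R[i]) : (complex.Re `|z| ^+ 2)%:C = `|z| ^+ 2 :> R[i].
    by rewrite normc_def rmorphXn.
  rewrite rmorphM [in LHS]/= ReK normrM exprMn horner_sqr_norm.
  rewrite normfV exprVn normC_one_sub_expi.
  rewrite mulr_sumr mulr_suml; apply: eq_bigr => n _.
  rewrite mulr_sumr mulr_suml; apply: eq_bigr => m _.
  have weightE : (1 + t ^+ 2 - 2 * t * cos x)^-1 * (2 * pi)^-1 =
      (2 * pi)^-1 / (1 - t ^+ 2) * poisson t x.
    by rewrite /poisson [RHS]mulrA divfK // mulrC.
  by rewrite -fmorphV mulrAC -rmorphM weightE rmorphM mulrACA.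
transitivity ((1 - t ^+ 2)%:C * cint (fun x =>
    \sum_(n < size f) \sum_(m < size f)
      w n m * ((poisson t x)%:C * (expi x ^+ n * (expi x)^* ^+ m)))).
  by rewrite -(eq_cint integrand) cint_real -rmorphM t2.
have pc n m : ccontinuous
    (fun x => (poisson t x)%:C * (expi x ^+ n * (expi x)^* ^+ m)).
  apply: ccontinuousM; first exact/ccontinuous_real/continuous_poisson.
  apply: ccontinuousM; apply: ccontinuousX; last apply: ccontinuous_conj;
    exact: ccontinuous_expi.
have wpc n m : ccontinuous
    (fun x => w n m * ((poisson t x)%:C * (expi x ^+ n * (expi x)^* ^+ m))).
  by apply: ccontinuousM => //; exact: ccontinuous_cst.
rewrite cint_sum; last by move=> n; apply: ccontinuous_sum.
rewrite mulr_sumr; apply: eq_bigr => n _.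
rewrite cint_sum // mulr_sumr; apply: eq_bigr => m _.
rewrite cintZ // cint_poisson_expi_conj // Amx_geometric // -/t -/r /w.
have cancelE : (1 - t ^+ 2) * ((2 * pi)^-1 / (1 - t ^+ 2)) *
    (2 * pi * t ^+ (maxn n m - minn n m)) = t ^+ (maxn n m - minn n m).
  (* [pi] is itself a doubled term, which [field] would unfold. *)
  by move: (pi : R) pin0 => p pn0; field; rewrite t2n0 pn0.
have realM (a b : R) : (a * b)%:C = a%:C * b%:C :> R[i] by exact: rmorphM.
have realX (a : R) k : (a ^+ k)%:C = a%:C ^+ k :> R[i] by exact: rmorphXn.
rewrite conj_real realM -[in RHS]cancelE !realM !realX; ring.
Qed.
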